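(* Let $G=G_1\times G_2$ be the direct product of two finite commutative groups, and let $A=A_1\times A_2$, where $A_1\subset G_1$ and $A_2\subset G_2$ are standard sets. Then \[ \overline\delta(A)=\overline\delta(A_1)\,\overline\delta(A_2)\quad\text{and}\quad \delta(A_1)\delta(A_2)\le\delta(A)\le\delta(A_1)\,\overline\delta(A_2). \]
   Context: Groups are written additively. For a finite commutative group $H$, a set $A\subset H$ is a standard set if $A=-A$ and $0\in A$; then $\Delta(A)=\max\{|B|:B\subset H,\ (B-B)\cap A=\{0\}\}$, $\delta(A)=\Delta(A)/|H|$, $\overline\Delta(A)=\max\{|B|:B\subset H,\ B-B\subset A\}$, $\overline\delta(A)=1/\overline\Delta(A)$. For $A_i$ these are computed in $G_i$, for $A$ in $G$. *)

(* Defs.v *)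
From HB Require Import structures.
From mathcomp Require Import all_boot all_order all_algebra.

Set Implicit Arguments.
Unset Strict Implicit.
Unset Printing Implicit Defensive.

Import GRing.Theory Num.Theory.
Local Open Scope ring_scope.

(* The library declares the product of two zmodTypes and of two finTypes, but not
   the join of the two structures. *)
HB.instance Definition _ (G1 G2 : finZmodType) :=
  GRing.Zmodule.on (G1 * G2)%type.

Section Standard.

Variable H : finZmodType.
Implicit Types A B : {set H}.

Definition oppset A : {set H} := [set - a | a in A].

Definition diffset A B : {set H} := [set a - b | a in A, b in B].

Definition standard A : Prop := A = oppset A /\ 0 \in A.

(* Empty maxima are 0 by convention. For standard [A] this convention is never
   used, here or in [Deltabar]: every singleton [B] is admissible. *)
Definition Delta A : nat :=
  \max_(B : {set H} | diffset B B :&: A == [set 0]) #|B|.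

Definition Deltabar A : nat :=
  \max_(B : {set H} | diffset B B \subset A) #|B|.

Definition delta A : rat := (Delta A)%:R / #|H|%:R.

Definition deltabar A : rat := 1 / (Deltabar A)%:R.

End Standard.

(* Main.v *)
Require Import Defs.
From HB Require Import structures.
From mathcomp Require Import all_boot all_order all_algebra.

Set Implicit Arguments.
Unset Strict Implicit.
Unset Printing Implicit Defensive.

Import GRing.Theory Num.Theory.
Local Open Scope ring_scope.

(** Products of admissible sets are admissible, and the two projections of a set
    [B] with [B - B] contained in [A1 x A2] are admissible for [A1] and [A2];
    this gives multiplicativity of [Deltabar] and the lower bound for [Delta].
    For the upper bound take [B] optimal for [Delta (A1 x A2)] and [C] optimal
    for [Deltabar A2].  For every translate [t + C], the points of [B] lying over
    it project injectively to an admissible set for [A1], so there are at most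
    [Delta A1] of them.  Each point of [B] lies over exactly [#|C|] translates,
    whence [Delta (A1 x A2) * Deltabar A2 <= #|G2| * Delta A1]. *)

Section Extremal.

Variables (H : finZmodType) (A : {set H}).
Hypothesis A0 : 0 \in A.

(** For nonempty [B] the hypothesis amounts to admissibility, since 0 lies in both [B - B] and [A].
    The empty set is not admissible, its difference set lacking 0, but its bound is trivial. *)
Lemma leq_Delta (B : {set H}) :
  {in B &, forall x y, x - y \in A -> x = y} -> (#|B| <= Delta A)%N.
Proof.
move=> sepB; have [->|[b Bb]] := set_0Vmem B; first by rewrite cards0.
apply: (bigmax_sup B) => //; apply/eqP/setP=> z.
rewrite !inE; apply/andP/eqP=> [[/imset2P[x y Bx By ->] Axy]|->].
  by rewrite (sepB x y) ?subrr.
by split=> //; apply/imset2P; exists b b; rewrite ?subrr.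
Qed.

Lemma Delta_witness :
  exists2 B : {set H}, {in B &, forall x y, x - y \in A -> x = y}
                     & #|B| = Delta A.
Proof.
(* An admissible set is needed for the maximum to be attained rather than be the default 0. *)
have adm0 : diffset [set 0] [set 0] :&: A == [set 0].
  apply/eqP/setP=> z; rewrite !inE.
  apply/andP/eqP=> [[/imset2P[x y /set1P-> /set1P-> ->] _]|->].
    by rewrite subrr.
  by split=> //; apply/imset2P; exists 0 0; rewrite ?subrr ?set11.
have [|B /eqP admB maxB] := @eq_bigmax_cond _
  (fun B : {set H} => diffset B B :&: A == [set 0]) (fun B => #|B|).
  by apply/card_gt0P; exists [set 0].
exists B => [x y Bx By Axy|]; last exact/esym.
apply/eqP; rewrite -subr_eq0 -in_set1 -admB inE Axy.
by rewrite andbT; apply: imset2_f.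
Qed.

Lemma leq_Deltabar (B : {set H}) :
  {in B &, forall x y, x - y \in A} -> (#|B| <= Deltabar A)%N.
Proof.
move=> clqB; apply: (bigmax_sup B) => //.
by apply/subsetP=> _ /imset2P[x y Bx By ->]; apply: clqB.
Qed.

Lemma Deltabar_gt0 : (0 < Deltabar A)%N.
Proof.
rewrite -(cards1 (0 : H)); apply: leq_Deltabar => x y /set1P-> /set1P->.
by rewrite subrr.
Qed.

Lemma Deltabar_witness :
  exists2 B : {set H}, {in B &, forall x y, x - y \in A} & #|B| = Deltabar A.
Proof.
have [|B /subsetP admB maxB] := @eq_bigmax_cond _
  (fun B : {set H} => diffset B B \subset A) (fun B => #|B|).
  apply/card_gt0P; exists set0; apply/subsetP=> z /imset2P[x y].
  by rewrite inE.
exists B => [x y Bx By|]; last exact/esym.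
by apply: admB; apply: imset2_f.
Qed.

End Extremal.

Section Product.

Variables (G1 G2 : finZmodType) (A1 : {set G1}) (A2 : {set G2}).
Hypotheses (A10 : 0 \in A1) (A20 : 0 \in A2).

Let A : {set (G1 * G2)%type} := setX A1 A2.

Let A0 : 0 \in A. Proof. by rewrite in_setX A10. Qed.

Lemma Deltabar_setX : Deltabar A = (Deltabar A1 * Deltabar A2)%N.
Proof.
apply/eqP; rewrite eqn_leq; apply/andP; split; last first.
  have [B1 clq1 <-] := Deltabar_witness A1.
  have [B2 clq2 <-] := Deltabar_witness A2.
  rewrite -cardsX; apply: leq_Deltabar => -[x1 x2] [y1 y2].
  rewrite !in_setX => /andP[/= Bx1 Bx2] /andP[By1 By2].
  by rewrite clq1 ?clq2.
have [B clq <-] := Deltabar_witness A.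
have le1 : (#|fst @: B| <= Deltabar A1)%N.
  apply: leq_Deltabar => _ _ /imsetP[x Bx ->] /imsetP[y By ->].
  by have := clq x y Bx By; rewrite inE => /andP[].
have le2 : (#|snd @: B| <= Deltabar A2)%N.
  apply: leq_Deltabar => _ _ /imsetP[x Bx ->] /imsetP[y By ->].
  by have := clq x y Bx By; rewrite inE => /andP[].
(* [B] lies in the product of its two projections. *)
apply: leq_trans (leq_mul le1 le2); rewrite -cardsX; apply/subset_leq_card.
by apply/subsetP=> x Bx; rewrite inE !imset_f.
Qed.

Lemma leq_Delta_setX : (Delta A1 * Delta A2 <= Delta A)%N.
Proof.
have [B1 sep1 <-] := Delta_witness A10.
have [B2 sep2 <-] := Delta_witness A20.
rewrite -cardsX; apply: leq_Delta => // -[x1 x2] [y1 y2].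
rewrite !in_setX => /andP[/= Bx1 Bx2] /andP[By1 By2] /andP[A1xy A2xy].
by rewrite (sep1 x1 y1) // (sep2 x2 y2).
Qed.

Lemma Delta_setX_leq : (Delta A * Deltabar A2 <= Delta A1 * #|G2|)%N.
Proof.
have [B sepB <-] := Delta_witness A0.
have [C clqC <-] := Deltabar_witness A2.
(* Double counting of the pairs [(x, t)] with [x] in [B] and [x.2] in [t + C]. *)
have -> : (#|B| * #|C| = \sum_(t : G2) #|[set x in B | (x.2 - t)%R \in C]|)%N.
  rewrite -sum_nat_const.
  under [RHS]eq_bigr do rewrite -sum1dep_card big_mkcondr /=.
  rewrite exchange_big; apply: eq_bigr => x _ /=; rewrite -big_mkcond /=.
  rewrite sum1dep_card.
  (* This map is an involution, so the [t] that suit [x] are exactly the image of [C]. *)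
  have subx_inj : injective (fun t => x.2 - t) by move=> s t /addrI/oppr_inj.
  rewrite -(card_imset C subx_inj); apply: eq_card => t; rewrite inE.
  apply/imsetP/idP=> [[c Cc ->]|Ct]; first by rewrite subKr.
  by exists (x.2 - t); rewrite ?subKr.
rewrite mulnC -sum_nat_const; apply: leq_sum => t _.
set Bt := [set _ in _ | _].
have sepBt : {in Bt &, forall x y, x.1 - y.1 \in A1 -> x = y}.
  move=> x y; rewrite !inE => /andP[Bx Cx] /andP[By Cy] A1xy.
  apply: sepB => //; rewrite inE A1xy /=.
  (* The translation cancels: [(x.2 - t) - (y.2 - t) = x.2 - y.2]. *)
  by have := clqC _ _ Cx Cy; rewrite opprB addrA subrK.
(* Equal first coordinates differ by 0, which is in [A1], so [fst] is injective on [Bt]. *)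
rewrite -(@card_in_imset _ _ fst Bt) => [|x y Bx By eqxy]; last first.
  by apply: sepBt => //; rewrite eqxy subrr.
apply: leq_Delta => // _ _ /imsetP[x Bx ->] /imsetP[y By ->] A1xy.
by rewrite (sepBt x y).
Qed.

End Product.

Theorem theorem8p2 (G1 G2 : finZmodType) (A1 : {set G1}) (A2 : {set G2})
    (hA1 : standard A1) (hA2 : standard A2) :
  let A : {set (G1 * G2)%type} := setX A1 A2 in
  deltabar A = deltabar A1 * deltabar A2 /\
  (delta A1 * delta A2 <= delta A /\ delta A <= delta A1 * deltabar A2).
Proof.
case: hA1 hA2 => _ A10 [_ A20] A.
have cardG_gt0 (G : finZmodType) : 0 < #|G|%:R :> rat.
  by rewrite ltr0n; apply/card_gt0P; exists 0.
have D2_gt0 : 0 < (Deltabar A2)%:R :> rat by rewrite ltr0n Deltabar_gt0.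
have cardE : #|{: G1 * G2}|%:R = #|G1|%:R * #|G2|%:R :> rat.
  by rewrite card_prod natrM.
split; first by rewrite /deltabar Deltabar_setX natrM !div1r invfM.
rewrite /delta /deltabar cardE; split.
  rewrite mulf_div ler_pM2r ?invr_gt0 ?mulr_gt0 // -natrM ler_nat.
  exact: leq_Delta_setX.
(* Denominators are cleared, then the common factor [#|G1|] cancels. *)
rewrite mulf_div mulr1 ler_pdivrMr ?mulr_gt0 // mulrAC ler_pdivlMr ?mulr_gt0 //.
rewrite mulrCA [leRHS]mulrCA ler_pM2l // -!natrM ler_nat.
exact: Delta_setX_leq.
Qed.
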